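(* Let $(g,f)=(d_{n,k})_{n,k\ge0}$ be a Riordan array with $f(t)=\sum_{j\ge1}f_jt^j$. Let $c=(c_0,c_1,\dots)$ with $c_0=1$ and $c_k\ne0$ for all $k$, and let $C=(c_{n,k})_{n,k\ge0}$ be lower triangular with $c_{n,0}=1$, $c_{n,k}\ne0$ for $0\le k\le n$ and $c_{n,k}=0$ for $k>n$. Put $d^{(c)}_{n,k}=\frac{c_n}{c_k}d_{n,k}$ and $d^{(C)}_{n,k}=\frac{c_{n,n}}{c_{n,k}}d_{n,k}$. Then for all $n,k\ge1$, $$d^{(c)}_{n,k}=\frac{c_n}{c_k}\sum_{j=1}^{n-k+1}f_j\frac{c_{k-1}}{c_{n-j}}d^{(c)}_{n-j,k-1}\quad\text{and}\quad d^{(C)}_{n,k}=\frac{c_{n,n}}{c_{n,k}}\sum_{j=1}^{n-k+1}f_j\frac{c_{n-j,k-1}}{c_{n-j,n-j}}d^{(C)}_{n-j,k-1}.$$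
   Context: $\mathbb{K}$ is $\mathbb{R}$ or $\mathbb{C}$. For $g\in\mathbb{K}[[t]]$ with $g(0)=1$ and $f\in\mathbb{K}[[t]]$ with $f(0)=0\ne f'(0)$, the Riordan array $(g,f)=(d_{n,k})_{n,k\ge0}$ is the infinite lower triangular matrix with $d_{n,k}=[t^n]g(t)f(t)^k$. The matrices $(d^{(c)}_{n,k})$ and $(d^{(C)}_{n,k})$ are called the $(c)$-Riordan array and $(C)$-Riordan array of $(g,f)$. *)

(* Defs.v *)
From HB Require Import structures.
From mathcomp Require Import all_boot all_order all_algebra.
From mathcomp Require Import reals.
From mathcomp Require Import complex.

Set Implicit Arguments.
Unset Strict Implicit.
Unset Printing Implicit Defensive.

Import Order.TTheory GRing.Theory Num.Theory.
Local Open Scope ring_scope.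

Variant scalar_kind := RealScalars | ComplexScalars.

Definition scalars (R : realType) (s : scalar_kind) : fieldType :=
  match s with
  | RealScalars => R
  | ComplexScalars => R[i]%C
  end.

(* A formal power series is its sequence of coefficients: [t^n] a = a n. *)
Definition fps (K : fieldType) := nat -> K.

Definition fps1 (K : fieldType) : fps K := fun n => (n == 0%N)%:R.

Definition fps_mul (K : fieldType) (a b : fps K) : fps K :=
  fun n => \sum_(i < n.+1) a i * b (n - i)%N.

Definition fps_exp (K : fieldType) (a : fps K) (k : nat) : fps K :=
  iter k (fps_mul a) (fps1 K).

Definition fps_deriv (K : fieldType) (a : fps K) : fps K :=
  fun n => a n.+1 *+ n.+1.

Definition riordan_pair (K : fieldType) (g f : fps K) : Prop :=
  [/\ g 0%N = 1, f 0%N = 0 & fps_deriv f 0%N != 0].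

Definition riordan (K : fieldType) (g f : fps K) (n k : nat) : K :=
  fps_mul g (fps_exp f k) n.

Definition c_riordan (K : fieldType) (c : nat -> K) (g f : fps K)
    (n k : nat) : K :=
  c n / c k * riordan g f n k.

(* For k > n the denominator vanishes, and so does riordan g f n k:
   the entry is 0. *)
Definition C_riordan (K : fieldType) (C : nat -> nat -> K) (g f : fps K)
    (n k : nat) : K :=
  C n n / C n k * riordan g f n k.

(* Main.v *)
Require Import Defs.
From HB Require Import structures.
From mathcomp Require Import all_boot all_order all_algebra.
From mathcomp Require Import reals.
From mathcomp Require Import complex.
From mathcomp Require Import zify ring.

Set Implicit Arguments.
Unset Strict Implicit.
Unset Printing Implicit Defensive.

Import Order.TTheory GRing.Theory Num.Theory.
Local Open Scope ring_scope.

(** Since [g f^(k+1) = f (g f^k)], comparing coefficients of [t^n] gives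
    [d_(n,k+1) = \sum_j f_j d_(n-j,k)], where [f_0 = 0] and the vanishing of
    [d_(m,k)] for [m < k] restrict [j] to [1 <= j <= n - k].  In each remaining
    term the weights are nonzero and cancel; the sequence [c] is the array of
    weights [c_(n,k) = c_k]. *)

Section FormalPowerSeries.
Variable K : fieldType.
Implicit Types a b f g : fps K.

(** The coefficient of [t^n] in a product involves only indices up to [n], so truncation to
    polynomials leaves it unchanged. *)
Lemma coef_mul_truncation a b (n m : nat) : (n < m)%N ->
  ((\poly_(i < m) a i) * (\poly_(i < m) b i))`_n = fps_mul a b n.
Proof.
move=> ltnm; rewrite coefM; apply: eq_bigr => i _; rewrite !coef_poly.
by rewrite (leq_ltn_trans (leq_ord i) ltnm) (leq_ltn_trans (leq_subr i n) ltnm).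
Qed.

Lemma fps_mulCA f g a (n : nat) :
  fps_mul g (fps_mul f a) n = fps_mul f (fps_mul g a) n.
Proof.
(* Truncating all three factors at [n.+1] moves the identity into the commutative ring of
   polynomials. *)
have mulE b1 b2 b3 : fps_mul b1 (fps_mul b2 b3) n =
    (\poly_(i < n.+1) b1 i *
      (\poly_(i < n.+1) b2 i * \poly_(i < n.+1) b3 i))`_n.
  rewrite coefM; apply: eq_bigr => i _; rewrite coef_poly ltn_ord.
  by rewrite coef_mul_truncation // ltnS leq_subr.
by rewrite !mulE mulrCA.
Qed.

(** Each factor [f] raises the order by at least one: in the convolution the index 0 gives
    [f 0 = 0], and an index [i.+1] leaves [n - i.+1 < k] for the previous power. *)
Lemma fps_exp_eq0 f (k n : nat) : f 0%N = 0 -> (n < k)%N -> fps_exp f k n = 0.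
Proof.
move=> f0; elim: k n => // k IHk n ltnk.
rewrite -[LHS]/(fps_mul f (fps_exp f k) n).
apply: big1 => -[[|i] ltin] _; first by rewrite f0 mul0r.
by rewrite IHk ?mulr0 //=; lia.
Qed.

Lemma riordan_eq0 g f (n k : nat) : f 0%N = 0 -> (n < k)%N ->
  riordan g f n k = 0.
Proof.
move=> f0 ltnk; apply: big1 => i _.
by rewrite fps_exp_eq0 ?mulr0 // (leq_ltn_trans (leq_subr _ _)).
Qed.

Lemma riordanS g f (n k : nat) : f 0%N = 0 ->
  riordan g f n k.+1 =
    \sum_(1 <= j < (n - k).+1) f j * riordan g f (n - j) k.
Proof.
move=> f0; rewrite [LHS]fps_mulCA /fps_mul.
rewrite -(big_mkord xpredT (fun j => f j * riordan g f (n - j) k)).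
(* The term [j = 0] drops out; the sum is then cut after [n - k], beyond which [n - j < k]. *)
rewrite big_ltn // f0 mul0r add0r (@big_cat_nat _ _ _ (n - k).+1) //=; last first.
  by rewrite ltnS leq_subr.
rewrite [X in _ + X]big_nat [X in _ + X]big1 ?addr0 // => j /andP[ltj lejn].
by rewrite riordan_eq0 ?mulr0 //; lia.
Qed.

Lemma C_riordanS (C : nat -> nat -> K) g f (n k : nat) : f 0%N = 0 ->
    (forall n k : nat, (k <= n)%N -> C n k != 0) ->
  C_riordan C g f n k.+1 =
    C n n / C n k.+1 *
      \sum_(1 <= j < (n - k).+1)
        f j * (C (n - j)%N k / C (n - j)%N (n - j)%N)
          * C_riordan C g f (n - j)%N k.
Proof.
(* The prefactor is the same on both sides, so no division by [C n k.+1] has to be justified, even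
   for [k.+1 > n]. *)
move=> f0 C_neq0; rewrite {1}/C_riordan riordanS //; congr (_ * _).
apply: eq_big_nat => j /andP[j_gt0 lej].
(* The upper bound [j <= n - k] places [(n - j, k)] inside the triangle. *)
have Cjk : C (n - j)%N k != 0 by apply: C_neq0; lia.
have Cjj := C_neq0 _ _ (leqnn (n - j)).
by rewrite /C_riordan; field; rewrite Cjk Cjj.
Qed.

End FormalPowerSeries.

Theorem theorem4p7 (R : realType) (s : scalar_kind)
    (g f : fps (scalars R s)) (hgf : riordan_pair g f)
    (c : nat -> scalars R s)
    (hc0 : c 0%N = 1) (hc : forall k : nat, c k != 0)
    (C : nat -> nat -> scalars R s)
    (hC0 : forall n : nat, C n 0%N = 1)
    (hC : forall n k : nat, (k <= n)%N -> C n k != 0)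
    (hCtri : forall n k : nat, (n < k)%N -> C n k = 0)
    (n k : nat) (hn : (1 <= n)%N) (hk : (1 <= k)%N) :
  c_riordan c g f n k =
    c n / c k *
      \sum_(1 <= j < (n.+1 - k).+1)
        f j * (c k.-1 / c (n - j)%N) * c_riordan c g f (n - j)%N k.-1
  /\
  C_riordan C g f n k =
    C n n / C n k *
      \sum_(1 <= j < (n.+1 - k).+1)
        f j * (C (n - j)%N k.-1 / C (n - j)%N (n - j)%N)
          * C_riordan C g f (n - j)%N k.-1.
Proof.
case: hgf => _ f0 _; case: k hk => // k' _; rewrite subSS; split.
  (* With all rows equal to [c], the diagonal entry [C n n] is [c n], and both sides agree by
     conversion. *)
  exact: (@C_riordanS _ (fun _ k => c k)).
exact: C_riordanS.
Qed.
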